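(* There exists $\theta_0>0$ such that for every $\theta\in(0,\theta_0)$ there exist a constant $R>0$ and a continuously differentiable function $Q=Q_\theta:[0,1]\to\mathbb{R}$ satisfying $$Q(0)=1\qquad\text{and}\qquad Q(y)+Q(1-y)=1\ \text{ for all } y\in[0,1],$$ such that $$\kappa:=1-\frac{\log c(P,Q,R)}{R}$$ satisfies $\kappa>\tfrac{2}{3}\theta>0$.
   Context: Throughout, $P(x)=x$. For a real constant $R>0$, a parameter $\theta>0$, and $Q\in C^1[0,1]$, set $w(y):=e^{Ry}Q(y)$ and $$c(P,Q,R):=1+\frac{1}{\theta}\int_0^1\int_0^1\big(w(y)P'(x)+\theta\, w'(y)P(x)\big)^2\,dx\,dy .$$ (In Levinson's method as refined by Conrey, when $\theta$ is the admissible length of the mollifier, $\kappa$ is a lower bound for the proportion of zeros of the Riemann zeta-function on the critical line.) *)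

(* Defs.v *)
(* Stdlib reals + Coquelicot. *)
From Stdlib Require Export Reals.
From Coquelicot Require Export Coquelicot.
Open Scope R_scope.

Definition Icc01 (y : R) : Prop := 0 <= y <= 1.

(* A function [0,1] -> R is represented by a total f : R -> R, of which only
   the values on [0,1] matter: D_in and continue_in are relative to the domain,
   so they are one-sided at the endpoints 0 and 1. *)
Definition C1_on_Icc01 (f : R -> R) : Prop :=
  exists df : R -> R,
    forall y : R, Icc01 y -> D_in f df Icc01 y /\ continue_in df Icc01 y.

Definition w (R0 : R) (Q : R -> R) (y : R) : R := exp (R0 * y) * Q y.

(* Derive is the two-sided derivative; inside (0,1) it is the derivative of the
   function on [0,1], and RInt does not depend on the integrand at the
   endpoints, so values of P and Q outside [0,1] play no role. *)
Definition c (theta : R) (P Q : R -> R) (R0 : R) : R :=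
  1 + 1 / theta *
    RInt (fun y : R =>
      RInt (fun x : R =>
        (w R0 Q y * Derive P x + theta * Derive (w R0 Q) y * P x) ^ 2) 0 1) 0 1.

Definition kappa (theta : R) (P Q : R -> R) (R0 : R) : R :=
  1 - ln (c theta P Q R0) / R0.

(* Main.v *)
(** Let [E = exp (- 1 / theta)] and rescale [y = 1/2 + theta s].  With [R0 = 1 / theta]
    and a transition [Q = exp (- 2 s) / 2] for [s > 0], extended by [Q(-s) = 1 - Q(s)],
    one finds [c E -> 1/2] as [theta -> 0], so that [kappa / theta -> ln 2 > 2/3].
    The profile is corrected by an affine change of size [E] to get [Q 1 = 0]. *)
Require Import Defs.
From Stdlib Require Import Reals Lra.
From Coquelicot Require Import Coquelicot.
Open Scope R_scope.

(** * From two-sided derivatives and continuity to their versions relative to a domain *)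

Lemma is_derive_D_in (f : R -> R) (df : R -> R) (D : R -> Prop) (y : R) :
  is_derive f y (df y) -> D_in f df D y.
Proof.
  intros H; apply is_derive_Reals in H.
  intros eps Heps; destruct (H eps Heps) as [d Hd].
  exists d; split; [apply cond_pos|].
  intros x [[_ Hne] Hx]; simpl in *; unfold Rdist in *.
  specialize (Hd (x - y)); replace (y + (x - y)) with x in Hd by ring.
  apply Hd; [lra | exact Hx].
Qed.

Lemma continuous_continue_in (f : R -> R) (D : R -> Prop) (y : R) :
  continuous f y -> continue_in f D y.
Proof.
  intros H; apply continuity_pt_filterlim in H.
  intros eps Heps; destruct (H eps Heps) as [d [Hd0 Hd]].
  exists d; split; [exact Hd0|].
  intros x [[_ Hne] Hx]; apply Hd; repeat split; auto.
Qed.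

(** * Gluing two functions at a point *)

Definition glue (a : R) (f g : R -> R) (y : R) : R :=
  if Rle_dec y a then f y else g y.

Lemma glue_left (a : R) (f g : R -> R) (y : R) : y <= a -> glue a f g y = f y.
Proof. intros H; unfold glue; destruct (Rle_dec y a); [reflexivity | lra]. Qed.

Lemma glue_right (a : R) (f g : R -> R) (y : R) : a < y -> glue a f g y = g y.
Proof. intros H; unfold glue; destruct (Rle_dec y a); [lra | reflexivity]. Qed.

Lemma glue_left_near (a : R) (f g : R -> R) (y : R) :
  y < a -> locally y (fun z => f z = glue a f g z).
Proof.
  intros H; generalize (open_lt a y H); apply filter_imp.
  intros z Hz; rewrite glue_left; [reflexivity | lra].
Qed.

Lemma glue_right_near (a : R) (f g : R -> R) (y : R) :
  a < y -> locally y (fun z => g z = glue a f g z).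
Proof.
  intros H; generalize (open_gt a y H); apply filter_imp.
  intros z Hz; rewrite glue_right; [reflexivity | exact Hz].
Qed.

(** Away from [a] the glued function agrees locally with one branch. At [a] the sign of the
    increment selects the branch, and [f a = g a] gives both difference quotients the same base
    value. *)
Lemma is_derive_glue (a : R) (f g df : R -> R) :
  f a = g a ->
  (forall y, y <= a -> is_derive f y (df y)) ->
  (forall y, a <= y -> is_derive g y (df y)) ->
  forall y, is_derive (glue a f g) y (df y).
Proof.
  intros Ha Hf Hg y.
  destruct (Rtotal_order y a) as [H | [-> | H]].
  - apply is_derive_ext_loc with f; [now apply glue_left_near | apply Hf; lra].
  - generalize (Hf a (Rle_refl a)) (Hg a (Rle_refl a)); rewrite !is_derive_Reals.
    intros Lf Lg eps Heps.
    destruct (Lf eps Heps) as [d1 H1]; destruct (Lg eps Heps) as [d2 H2].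
    exists (mkposreal _ (Rmin_pos d1 d2 (cond_pos d1) (cond_pos d2))); simpl.
    intros h Hh Hd.
    rewrite (glue_left a f g a (Rle_refl a)).
    destruct (Rle_dec h 0).
    + rewrite glue_left by lra.
      apply H1; [exact Hh | apply Rlt_le_trans with (1 := Hd), Rmin_l].
    + rewrite glue_right by lra; rewrite Ha.
      apply H2; [exact Hh | apply Rlt_le_trans with (1 := Hd), Rmin_r].
  - apply is_derive_ext_loc with g; [now apply glue_right_near | apply Hg; lra].
Qed.

(** * Reduction of the double integral to a one-dimensional energy *)

Ltac eq_in_R := lazymatch goal with |- ?a = ?b => change (@eq R a b) end.

Lemma RInt_affine_square (a b : R) :
  RInt (fun x : R => (a * Derive (fun t : R => t) x + b * x) ^ 2) 0 1
  = a ^ 2 + a * b + b ^ 2 / 3.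
Proof.
  apply is_RInt_unique.
  replace (a ^ 2 + a * b + b ^ 2 / 3) with
    (minus ((fun x => a ^ 2 * x + a * b * x ^ 2 + b ^ 2 / 3 * x ^ 3) 1)
           ((fun x => a ^ 2 * x + a * b * x ^ 2 + b ^ 2 / 3 * x ^ 3) 0))
    by (unfold minus, plus, opp; simpl; eq_in_R; field).
  apply is_RInt_ext with (fun x => (a + b * x) ^ 2).
  { intros x _; rewrite Derive_id; eq_in_R; ring. }
  apply (is_RInt_derive (fun x => a ^ 2 * x + a * b * x ^ 2 + b ^ 2 / 3 * x ^ 3)
                        (fun x => (a + b * x) ^ 2)).
  - intros x _; auto_derive; [trivial | field].
  - intros x _; apply (ex_derive_continuous (fun x : R => (a + b * x) ^ 2)).
    auto_derive; trivial.
Qed.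

(** The inner integral over [x] for [P x = x], taken at [a = v y] and [b = theta * Derive v y]. *)
Definition energy (theta : R) (v : R -> R) (y : R) : R :=
  v y ^ 2 + v y * (theta * Derive v y) + (theta * Derive v y) ^ 2 / 3.

Lemma c_energy (theta : R) (Q : R -> R) (R0 : R) :
  c theta (fun x => x) Q R0 = 1 + 1 / theta * RInt (energy theta (w R0 Q)) 0 1.
Proof.
  unfold c; do 2 f_equal; apply RInt_ext; intros y _.
  apply RInt_affine_square.
Qed.

(** The energy contains a derivative, so agreement near [y] is required. This is what lets a single
    branch replace a glued function. *)
Lemma energy_ext_loc (theta : R) (u v : R -> R) (y : R) :
  locally y (fun z => u z = v z) -> energy theta u y = energy theta v y.
Proof.
  intros H; unfold energy.
  rewrite (Derive_ext_loc _ _ _ H), (locally_singleton _ _ H); reflexivity.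
Qed.

(** * Explicit antiderivatives of the energy of exponential sums *)

Section ExponentialProfiles.

Variables theta T : R.
Hypothesis thetaT : theta * T = 1.

Lemma is_RInt_energy_left (al be a b : R) :
  let G y := theta * (7 / 6 * al ^ 2 * exp (T * y) ^ 2
             - 2 * al * be * exp (T * y) ^ 4 + 7 / 6 * be ^ 2 * exp (T * y) ^ 6) in
  is_RInt (energy theta (fun y => al * exp (T * y) - be * exp (T * y) ^ 3)) a b
    (G b - G a).
Proof.
  intros G.
  apply is_RInt_ext with (fun y => 7 / 3 * al ^ 2 * exp (T * y) ^ 2
    - 8 * al * be * exp (T * y) ^ 4 + 7 * be ^ 2 * exp (T * y) ^ 6).
  { intros y _; unfold energy; eq_in_R.
    replace (theta * Derive _ y) with (al * exp (T * y) - 3 * be * exp (T * y) ^ 3).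
    - field.
    - symmetry; erewrite is_derive_unique; [|auto_derive; [trivial|reflexivity]].
      transitivity (theta * T * (al * exp (T * y) - 3 * be * exp (T * y) ^ 3)).
      + simpl; ring.
      + rewrite thetaT; ring. }
  apply (is_RInt_derive G).
  - intros y _; unfold G; auto_derive; [trivial|].
    replace theta with (/ T) by (apply Rmult_eq_reg_r with T; [rewrite thetaT; field|]; nra).
    simpl; field; nra.
  - intros y _.
    apply (ex_derive_continuous (fun y => 7 / 3 * al ^ 2 * exp (T * y) ^ 2
      - 8 * al * be * exp (T * y) ^ 4 + 7 * be ^ 2 * exp (T * y) ^ 6)).
    auto_derive; trivial.
Qed.

(** The two exponentials are inverse to each other, so the cross term of the energy is constant and
    contributes the linear term of [G]. *)
Lemma is_RInt_energy_right (be ga a b : R) :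
  let G y := theta * (7 / 6 * be ^ 2 * exp (T * y) ^ 2 - ga ^ 2 / 6 * exp (- (T * y)) ^ 2)
             - 4 / 3 * ga * be * y in
  is_RInt (energy theta (fun y => ga * exp (- (T * y)) - be * exp (T * y))) a b
    (G b - G a).
Proof.
  intros G.
  assert (Hexp : forall y, exp (- (T * y)) * exp (T * y) = 1).
  { intros y; rewrite <- exp_plus, <- exp_0; f_equal; ring. }
  apply is_RInt_ext with (fun y => 7 / 3 * be ^ 2 * exp (T * y) ^ 2
    - 4 / 3 * ga * be + ga ^ 2 / 3 * exp (- (T * y)) ^ 2).
  { intros y _; unfold energy; eq_in_R.
    replace (theta * Derive _ y) with (- ga * exp (- (T * y)) - be * exp (T * y)).
    - transitivity (7 / 3 * be ^ 2 * exp (T * y) ^ 2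
        - 4 / 3 * ga * be * (exp (- (T * y)) * exp (T * y))
        + ga ^ 2 / 3 * exp (- (T * y)) ^ 2); [rewrite Hexp; ring | field].
    - symmetry; erewrite is_derive_unique; [|auto_derive; [trivial|reflexivity]].
      transitivity (theta * T * (- ga * exp (- (T * y)) - be * exp (T * y))).
      + simpl; ring.
      + rewrite thetaT; ring. }
  apply (is_RInt_derive G).
  - intros y _; unfold G; auto_derive; [trivial|].
    replace theta with (/ T) by (apply Rmult_eq_reg_r with T; [rewrite thetaT; field|]; nra).
    simpl; field; nra.
  - intros y _.
    apply (ex_derive_continuous (fun y => 7 / 3 * be ^ 2 * exp (T * y) ^ 2
      - 4 / 3 * ga * be + ga ^ 2 / 3 * exp (- (T * y)) ^ 2)).
    auto_derive; trivial.
Qed.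

End ExponentialProfiles.

(** * The transition function and its weighted form *)

Definition profile (T y : R) : R :=
  (exp (- (T * (2 * y - 1))) - exp (- T)) / (2 * (1 - exp (- T))).

(** [profile T] is the decay [exp (- 2 s) / 2], with [s = T * (y - 1 / 2)], made affine so as to
    equal 1/2 at [y = 1 / 2] and 0 at [y = 1]. The left branch is its reflection, which builds in
    the symmetry. *)
Definition Qopt (T : R) : R -> R :=
  glue (1 / 2) (fun y => 1 - profile T (1 - y)) (profile T).

Section Profile.

Variable T : R.
Hypothesis T_pos : 0 < T.

Lemma exp_opp_lt_1 : exp (- T) < 1.
Proof. rewrite <- exp_0; apply exp_increasing; lra. Qed.

Lemma profile_half : profile T (1 / 2) = 1 / 2.
Proof.
  unfold profile; replace (- (T * (2 * (1 / 2) - 1))) with 0 by field.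
  rewrite exp_0; pose proof exp_opp_lt_1; field; lra.
Qed.

Lemma profile_1 : profile T 1 = 0.
Proof.
  unfold profile; replace (- (T * (2 * 1 - 1))) with (- T) by ring.
  unfold Rdiv; ring.
Qed.

Lemma Qopt_0 : Qopt T 0 = 1.
Proof.
  unfold Qopt; rewrite glue_left by lra.
  rewrite Rminus_0_r, profile_1; ring.
Qed.

Lemma Qopt_sym (y : R) : Qopt T y + Qopt T (1 - y) = 1.
Proof.
  unfold Qopt; destruct (Rtotal_order y (1 / 2)) as [H | [-> | H]].
  - rewrite glue_left, glue_right by lra; ring.
  - rewrite !glue_left by lra.
    replace (1 - (1 - 1 / 2)) with (1 / 2) by field.
    replace (1 - 1 / 2) with (1 / 2) by field.
    rewrite profile_half; field.
  - rewrite glue_right, glue_left by lra.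
    replace (1 - (1 - y)) with y by ring; ring.
Qed.

Lemma Qopt_C1 : C1_on_Icc01 (Qopt T).
Proof.
  pose proof exp_opp_lt_1 as HE.
  (* Reflection through the point (1/2, 1/2) preserves slopes, so the derivative depends only on the
     distance to 1/2 and is continuous there. *)
  exists (fun y => - (T / (1 - exp (- T)) * exp (- (T * Rabs (2 * y - 1))))).
  intros y _; split.
  - apply is_derive_D_in.
    apply (is_derive_glue _ _ _
             (fun y => - (T / (1 - exp (- T)) * exp (- (T * Rabs (2 * y - 1)))))).
    + replace (1 - 1 / 2) with (1 / 2) by field; rewrite profile_half; field.
    + intros z Hz; rewrite Rabs_left1 by lra; unfold profile.
      auto_derive; [trivial|].
      replace (2 * (1 + - z) + - (1)) with (- (2 * z - 1)) by ring.
      field; lra.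
    + intros z Hz; rewrite Rabs_pos_eq by lra; unfold profile.
      auto_derive; [trivial|].
      change (2 * z + - (1)) with (2 * z - 1); field; lra.
  - apply continuous_continue_in.
    apply (continuous_opp (fun y => T / (1 - exp (- T)) * exp (- (T * Rabs (2 * y - 1))))).
    apply (continuous_scal_r (T / (1 - exp (- T)))
             (fun y => exp (- (T * Rabs (2 * y - 1))))).
    apply continuous_comp; [|apply continuous_exp].
    apply (continuous_opp (fun y => T * Rabs (2 * y - 1))).
    apply (continuous_scal_r T (fun y => Rabs (2 * y - 1))).
    apply (continuous_comp (fun y => 2 * y - 1) Rabs).
    + apply (ex_derive_continuous (fun y : R => 2 * y - 1)); auto_derive; trivial.
    + apply continuous_Rabs.
Qed.

(** The reflected decay equals [E * exp (T * y) ^ 2], so the weight turns it into a cube. *)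
Lemma w_Qopt_left (y : R) :
  let E := exp (- T) in
  exp (T * y) * (1 - profile T (1 - y))
  = (2 - E) / (2 * (1 - E)) * exp (T * y) - E / (2 * (1 - E)) * exp (T * y) ^ 3.
Proof.
  intros E; pose proof exp_opp_lt_1 as HE; fold E in HE; unfold profile; fold E.
  replace (exp (- (T * (2 * (1 - y) - 1)))) with (E * exp (T * y) ^ 2).
  - field; lra.
  - unfold E; simpl; rewrite Rmult_1_r, <- !exp_plus; f_equal; ring.
Qed.

(** The decay is twice as fast as the growth of the weight, which leaves a multiple of
    [exp (- (T * y))]. *)
Lemma w_Qopt_right (y : R) :
  let E := exp (- T) in
  exp (T * y) * profile T y
  = 1 / (2 * E * (1 - E)) * exp (- (T * y)) - E / (2 * (1 - E)) * exp (T * y).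
Proof.
  intros E; pose proof exp_opp_lt_1 as HE; fold E in HE; unfold profile; fold E.
  pose proof (exp_pos (- T)) as HE0; fold E in HE0.
  assert (H : E * (exp (T * y) * exp (- (T * (2 * y - 1)))) = exp (- (T * y))).
  { unfold E; rewrite <- !exp_plus; f_equal; ring. }
  rewrite <- H; field; lra.
Qed.

End Profile.

(** * Closed form of [c] and its bounds for small [theta] *)

Lemma c_Qopt (theta : R) :
  0 < theta ->
  let E := exp (- / theta) in
  c theta (fun x => x) (Qopt (/ theta)) (/ theta)
  = 1 + (6 - 13 * E + 13 * E ^ 2) / (12 * E * (1 - E)) - / theta / (6 * (1 - E) ^ 2).
Proof.
  intros Ht E; rewrite c_energy.
  set (T := / theta).
  assert (HT : 0 < T) by now apply Rinv_0_lt_compat.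
  assert (HtT : theta * T = 1) by (unfold T; field; lra).
  assert (HE0 : 0 < E) by apply exp_pos.
  assert (HE1 : E < 1) by now apply exp_opp_lt_1.
  set (al := (2 - E) / (2 * (1 - E))); set (be := E / (2 * (1 - E))).
  set (ga := 1 / (2 * E * (1 - E))).
  pose proof (is_RInt_energy_left theta T HtT al be 0 (1 / 2)) as IL.
  pose proof (is_RInt_energy_right theta T HtT be ga (1 / 2) 1) as IR.
  cbv beta zeta in IL, IR.
  (* Only interior points of each half-interval matter, and near them [Qopt] is a single branch. *)
  eapply (is_RInt_ext _ (energy theta (w T (Qopt T)))) in IL.
  2: { rewrite Rmin_left, Rmax_right by lra; intros y [_ Hy].
       apply energy_ext_loc.
       generalize (glue_left_near (1 / 2) (fun y => 1 - profile T (1 - y)) (profile T) y Hy).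
       apply filter_imp; intros z Hz; unfold w, Qopt; rewrite <- Hz.
       symmetry; now apply w_Qopt_left. }
  eapply (is_RInt_ext _ (energy theta (w T (Qopt T)))) in IR.
  2: { rewrite Rmin_left, Rmax_right by lra; intros y [Hy _].
       apply energy_ext_loc.
       generalize (glue_right_near (1 / 2) (fun y => 1 - profile T (1 - y)) (profile T) y Hy).
       apply filter_imp; intros z Hz; unfold w, Qopt; rewrite <- Hz.
       symmetry; now apply w_Qopt_right. }
  rewrite (is_RInt_unique _ _ _ _ (is_RInt_Chasles _ _ _ _ _ _ IL IR)).
  assert (H0 : exp (T * 0) = 1) by (rewrite Rmult_0_r; apply exp_0).
  assert (H1 : exp (T * 1) = / E).
  { rewrite Rmult_1_r; unfold E; rewrite exp_Ropp, Rinv_inv; reflexivity. }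
  (* The midpoint value enters only through even powers, so everything is rational in [E], apart
     from the linear term, which yields the summand with [/ theta]. *)
  assert (Hh : exp (T * (1 / 2)) ^ 2 = / E).
  { rewrite <- H1; simpl; rewrite Rmult_1_r, <- exp_plus; f_equal; field. }
  assert (H4 : exp (T * (1 / 2)) ^ 4 = (/ E) ^ 2) by (rewrite <- Hh; ring).
  assert (H6 : exp (T * (1 / 2)) ^ 6 = (/ E) ^ 3) by (rewrite <- Hh; ring).
  assert (Hh' : (/ exp (T * (1 / 2))) ^ 2 = E) by (rewrite pow_inv, Hh; apply Rinv_inv).
  rewrite !exp_Ropp, H6, H4, Hh', Hh, H0, H1.
  unfold plus; simpl; unfold al, be, ga, T; field; lra.
Qed.

(** Raise [1 + x <= exp x] at [x = - 1 / 24] to the power 16. The excess over 1/2 leaves room for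
    the error [E]. *)
Lemma exp_opp_2_3 : 506 / 1000 < exp (- (2 / 3)).
Proof.
  assert (H : 23 / 24 <= exp (- (1 / 24))).
  { pose proof (exp_ineq1_le (- (1 / 24))); lra. }
  apply Rlt_le_trans with ((23 / 24) ^ 16); [lra|].
  replace (exp (- (2 / 3))) with (exp (- (1 / 24)) ^ 16).
  - apply pow_incr; lra.
  - simpl; rewrite Rmult_1_r, <- !exp_plus; f_equal; field.
Qed.

(** The upper bound is the value of [c] at which [kappa] would equal [2 / 3 * theta]; positivity
    allows taking logarithms. *)
Lemma c_Qopt_bounds (theta : R) :
  0 < theta < 1 / 1000 ->
  0 < c theta (fun x => x) (Qopt (/ theta)) (/ theta) < exp (/ theta - 2 / 3).
Proof.
  intros Ht; rewrite c_Qopt by lra; cbv zeta.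
  set (T := / theta).
  assert (HT : 1000 < T).
  { replace 1000 with (/ (1 / 1000)) by field; apply Rinv_lt_contravar; nra. }
  assert (HtT : theta * T = 1) by (unfold T; field; lra).
  set (E := exp (- T)).
  assert (HE0 : 0 < E) by apply exp_pos.
  assert (HE : E * exp T = 1) by (unfold E; rewrite <- exp_plus, <- exp_0; f_equal; ring).
  assert (HET : E * T < 1).
  { pose proof (exp_ineq1_le T); nra. }
  assert (HE1 : E < 1 / 1000) by nra.
  assert (Hlast : 0 < T / (6 * (1 - E) ^ 2)) by (apply Rdiv_lt_0_compat; nra).
  split.
  - apply Rplus_lt_reg_r with (T / (6 * (1 - E) ^ 2)).
    assert (T / (6 * (1 - E) ^ 2) < (6 - 13 * E + 13 * E ^ 2) / (12 * E * (1 - E))); [|lra].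
    apply Rmult_lt_reg_r with (12 * E * (1 - E) ^ 2); [nra|].
    replace (T / (6 * (1 - E) ^ 2) * (12 * E * (1 - E) ^ 2)) with (2 * (E * T)) by (field; lra).
    replace (_ / _ * _) with ((6 - 13 * E + 13 * E ^ 2) * (1 - E)) by (field; lra).
    nra.
  (* After clearing denominators this reads [13 * E ^ 2 <= 7 * E]. The negative last term of [c] is
     then dropped, and multiplying by [E] reduces the claim to [E + 1 / 2 <= exp (- (2 / 3))]. *)
  - assert (Hm : (6 - 13 * E + 13 * E ^ 2) / (12 * E * (1 - E)) <= / (2 * E)).
    { apply Rmult_le_reg_r with (12 * E * (1 - E)); [nra|].
      replace (_ / _ * _) with (6 - 13 * E + 13 * E ^ 2) by (field; lra).
      replace (/ (2 * E) * _) with (6 * (1 - E)) by (field; lra).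
      nra. }
    apply Rlt_le_trans with (1 + / (2 * E)); [lra|].
    unfold Rminus; rewrite exp_plus.
    replace (exp T) with (/ E) by (apply Rmult_eq_reg_l with E; [rewrite HE; field|]; lra).
    apply Rmult_le_reg_l with E; [exact HE0|].
    replace (E * (1 + / (2 * E))) with (E + 1 / 2) by (field; lra).
    replace (E * (/ E * exp (- (2 / 3)))) with (exp (- (2 / 3))) by (field; lra).
    pose proof exp_opp_2_3; lra.
Qed.

Theorem theorem1 :
  exists theta0 : R, 0 < theta0 /\
    forall theta : R, 0 < theta < theta0 ->
      exists (R0 : R) (Q : R -> R),
        0 < R0 /\
        C1_on_Icc01 Q /\
        Q 0 = 1 /\
        (forall y : R, 0 <= y <= 1 -> Q y + Q (1 - y) = 1) /\
        kappa theta (fun x : R => x) Q R0 > 2 / 3 * theta /\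
        2 / 3 * theta > 0.
Proof.
  exists (1 / 1000); split; [lra|].
  intros theta Ht; exists (/ theta), (Qopt (/ theta)).
  assert (HT : 0 < / theta) by (apply Rinv_0_lt_compat; lra).
  repeat split.
  - exact HT.
  - now apply Qopt_C1.
  - apply Qopt_0.
  - intros y _; now apply Qopt_sym.
  - destruct (c_Qopt_bounds theta Ht) as [Hc0 Hc].
    (* This gives [ln c < / theta - 2 / 3]; multiplication by [theta] turns it into
       [theta * ln c < 1 - 2 / 3 * theta]. *)
    apply (ln_increasing _ _ Hc0) in Hc; rewrite ln_exp in Hc.
    unfold kappa, Rdiv at 1; rewrite Rinv_inv.
    apply (Rmult_lt_compat_r theta) in Hc; [|lra].
    rewrite Rmult_minus_distr_r, Rinv_l in Hc; lra.
  - lra.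
Qed.
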